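(* Let $\mathcal G=(\mathcal V,\mathcal E_0)$ be a connected undirected graph with $N$ nodes that is not bipartite, and let $\mathbf A_c\in\mathbb R^{(N+K)\times(N+K)}$ be the signed adjacency matrix obtained by adding $K$ collapsing nodes, as defined in the context. Consider the propagation $$\mathbf H^{(\ell+1)}=\sigma_\ell\big(\mathbf A_c\,\mathbf H^{(\ell)}\mathbf W_{\mathrm{in}}^{(\ell)}\big),\qquad \ell\ge 0,$$ where $\sigma_\ell$ is a differentiable activation function applied entrywise, $\mathbf W_{\mathrm{in}}^{(\ell)}$ is a real matrix of compatible size, and $\mathbf H^{(0)}$ is the matrix of initial node features. Let $\mathbf h_i^{(\ell)}$ denote the (transposed) $i$-th row of $\mathbf H^{(\ell)}$ and $\mathbf x_s=\mathbf h_s^{(0)}$. Let $i,s\in\mathcal V$. If $|\sigma_\ell'|\le\alpha$ and $\|\mathbf W_{\mathrm{in}}^{(\ell)}\|\le\beta_{\mathrm{in}}$ for $0\le\ell\le r$, then $$\left\|\frac{\partial\mathbf h_i^{(r)}}{\partial\mathbf x_s}\right\|\le(2\alpha\beta_{\mathrm{in}})^{r}\left(\sum_{\ell=0}^{r}|\mathbf A_c|^{\ell}\right)_{i,s}.$$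
   Context: $\|\cdot\|$ is the spectral norm of a matrix, $\partial\mathbf h_i^{(r)}/\partial\mathbf x_s$ is the Jacobian matrix, and $|\mathbf A_c|$ is the matrix of entrywise absolute values of $\mathbf A_c$ (and $|\mathbf A_c|^\ell$ its $\ell$-th matrix power). The initial features of all $N+K$ nodes, i.e. rows of $\mathbf H^{(0)}$, are treated as independent variables. $\mathbf A\in\{0,1\}^{N\times N}$ is the adjacency matrix of $\mathcal G$. $y_i$ denotes the label of node $i$ (known for some nodes) and $\tilde y_k$ the label of collapsing node $k$, $k=1,\dots,K$. The collapsing nodes are additional nodes, connected to the original nodes via $\mathbf C\in\mathbb R^{N\times K}$ with $C_{i,k}=+1$ if $y_i$ is known and $y_i=\tilde y_k$; $C_{i,k}=-1$ if $y_i$ is known and $y_i\ne\tilde y_k$; $C_{i,k}=0$ otherwise, and $$\mathbf A_c=\begin{bmatrix}\mathbf A&\mathbf C\\ \mathbf C^\top&\mathbf 0\end{bmatrix}.$$ *)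

(* Defs.v *)
From mathcomp Require Import all_boot all_order all_algebra.
From mathcomp Require Import all_classical all_reals all_analysis.

Set Implicit Arguments.
Unset Strict Implicit.
Unset Printing Implicit Defensive.

Import Order.TTheory GRing.Theory Num.Theory.
Import numFieldNormedType.Exports.

Local Open Scope classical_set_scope.
Local Open Scope ring_scope.

(* An undirected graph on the nodes 'I_N is a symmetric edge relation; loops
   are not excluded. *)

Definition connected_graph (N : nat) (e : rel 'I_N) : Prop :=
  forall u v : 'I_N, connect e u v.

Definition bipartite (N : nat) (e : rel 'I_N) : Prop :=
  exists S : {set 'I_N}, forall u v : 'I_N, e u v -> (u \in S) != (v \in S).

Definition adjacency (R : realType) (N : nat) (e : rel 'I_N) : 'M[R]_N :=
  \matrix_(u, v) (e u v)%:R.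

(* [y u] is meaningful only for [u \in known]. *)
Definition collapse_mx (R : realType) (N K : nat) (L : eqType)
    (known : {set 'I_N}) (y : 'I_N -> L) (yt : 'I_K -> L) : 'M[R]_(N, K) :=
  \matrix_(u, k)
    if u \in known then (if y u == yt k then 1 else - 1) else 0.

Definition signed_adjacency (R : realType) (N K : nat) (e : rel 'I_N)
    (L : eqType) (known : {set 'I_N}) (y : 'I_N -> L) (yt : 'I_K -> L) :
    'M[R]_(N + K) :=
  block_mx (adjacency R e) (collapse_mx R known y yt)
           (collapse_mx R known y yt)^T 0.

Definition absmx (R : realType) (m n : nat) (A : 'M[R]_(m, n)) : 'M[R]_(m, n) :=
  map_mx (fun x : R => `|x|) A.

(* The library norm on matrices is the max norm, whence the next two
   definitions. *)
Definition l2norm (R : realType) (n : nat) (x : 'cV[R]_n) : R :=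
  Num.sqrt (\sum_(a < n) x a 0 ^+ 2).

Definition spectral_norm (R : realType) (m n : nat) (A : 'M[R]_(m, n)) : R :=
  sup [set l2norm (A *m x) | x in [set x : 'cV[R]_n | l2norm x <= 1]].

(* [d l] is the number of features at layer [l]. *)
Fixpoint propagate (R : realType) (n : nat) (Ac : 'M[R]_n) (d : nat -> nat)
    (W : forall l : nat, 'M[R]_(d l, d l.+1)) (sigma : nat -> R -> R)
    (H0 : 'M[R]_(n, d 0%N)) (l : nat) {struct l} : 'M[R]_(n, d l) :=
  if l is l'.+1
  then map_mx (sigma l') (Ac *m propagate Ac W sigma H0 l' *m W l')
  else H0.

Definition set_row (R : realType) (m n : nat) (s : 'I_m) (x : 'rV[R]_n)
    (H : 'M[R]_(m, n)) : 'M[R]_(m, n) :=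
  \matrix_(u, a) if u == s then x 0 a else H u a.

(* The matrix of the partial derivatives of the features of node [i] at layer
   [r] (row index) with respect to the initial features of node [s] (column
   index), at the point [H0], the other rows of [H0] being held fixed.  The
   library's [jacobian] acts on row vectors by right multiplication, hence the
   transposition. *)
Definition node_jacobian (R : realType) (n : nat) (Ac : 'M[R]_n)
    (d : nat -> nat) (W : forall l : nat, 'M[R]_(d l, d l.+1))
    (sigma : nat -> R -> R) (H0 : 'M[R]_(n, d 0%N)) (r : nat) (i s : 'I_n) :
    'M[R]_(d r, d 0%N) :=
  (jacobian (fun x : 'rV[R]_(d 0%N) =>
               row i (propagate Ac W sigma (set_row s x H0) r))
            (row s H0))^T.

(* Main.v *)
(* By the chain rule the derivatives of the layers satisfy
   dH^(l+1) = sigma_l'(A H^(l) W_l) .* (A dH^(l) W_l), so the norm of row [u]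
   of dH^(l+1) is at most alpha * beta times the sum over [w] of |A_(u,w)|
   times the norm of row [w] of dH^(l).  Hence the Jacobian is bounded by
   (alpha beta)^r (|A|^r)_(i,s); the factor 2^r and the powers |A|^l with
   l < r only weaken this. *)
From HB Require Import structures.
Require Import Defs.
From mathcomp Require Import all_boot all_order all_algebra.
From mathcomp Require Import all_classical all_reals all_analysis.
From mathcomp Require Import ring.

Set Implicit Arguments.
Unset Strict Implicit.
Unset Printing Implicit Defensive.

Import Order.TTheory GRing.Theory Num.Theory.
Import numFieldNormedType.Exports.

Local Open Scope ring_scope.

(** * Euclidean norm of columns and the spectral norm it induces *)

Section EuclideanNorm.
Variable R : realType.
Implicit Types m n : nat.

Lemma l2norm_ge0 n (x : 'cV[R]_n) : 0 <= l2norm x.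
Proof. exact: sqrtr_ge0. Qed.

Lemma sqr_l2norm n (x : 'cV[R]_n) : l2norm x ^+ 2 = \sum_a x a 0 ^+ 2.
Proof. by rewrite sqr_sqrtr// sumr_ge0// => a _; exact: sqr_ge0. Qed.

Lemma l2norm0 n : l2norm (0 : 'cV[R]_n) = 0.
Proof. by rewrite /l2norm big1 ?sqrtr0// => a _; rewrite mxE expr0n. Qed.

Lemma l2normZ n (c : R) (x : 'cV[R]_n) : l2norm (c *: x) = `|c| * l2norm x.
Proof.
rewrite /l2norm -sqrtr_sqr -sqrtrM ?sqr_ge0// mulr_sumr.
by congr Num.sqrt; apply: eq_bigr => a _; rewrite mxE exprMn.
Qed.

Lemma l2norm_eq0 n (x : 'cV[R]_n) : l2norm x = 0 -> x = 0.
Proof.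
move=> x0; have := sqr_l2norm x; rewrite x0 expr0n/= => /esym/eqP.
rewrite psumr_eq0 => [/allP x0'|a _]; last exact: sqr_ge0.
apply/colP => a; rewrite mxE; apply/eqP.
by have := x0' a (mem_index_enum _); rewrite sqrf_eq0.
Qed.

Lemma l2norm_le n c (x y : 'cV[R]_n) : 0 <= c ->
  (forall a, `|x a 0| <= c * `|y a 0|) -> l2norm x <= c * l2norm y.
Proof.
move=> c0 xy; rewrite -[c in leRHS]ger0_norm// -l2normZ.
apply: ler_wsqrtr; apply: ler_sum => a _.
by rewrite -real_normK ?num_real// -[leRHS]real_normK ?num_real//
  lerXn2r ?nnegrE// mxE normrM (ger0_norm c0).
Qed.

(** Expanding the sum of the squares [(|y| x_a - |x| y_a)^2] gives [2 |x| |y| (|x| |y| - <x, y>)].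
    Once zero vectors are set aside, the factor [2 |x| |y|] is positive and can be cancelled. *)
Lemma cauchy_schwarz n (x y : 'cV[R]_n) :
  \sum_a x a 0 * y a 0 <= l2norm x * l2norm y.
Proof.
have [/l2norm_eq0->|y0] := eqVneq (l2norm y) 0.
  by rewrite l2norm0 mulr0 big1// => a _; rewrite mxE mulr0.
have [/l2norm_eq0->|x0] := eqVneq (l2norm x) 0.
  by rewrite l2norm0 mul0r big1// => a _; rewrite mxE mul0r.
have xy : 0 < l2norm x * l2norm y.
  by rewrite mulr_gt0// lt0r ?x0 ?y0 l2norm_ge0.
have : 0 <= \sum_a (l2norm y * x a 0 - l2norm x * y a 0) ^+ 2.
  by apply: sumr_ge0 => a _; exact: sqr_ge0.
have -> : \sum_a (l2norm y * x a 0 - l2norm x * y a 0) ^+ 2 =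
    2 * (l2norm x * l2norm y) *
    (l2norm x * l2norm y - \sum_a x a 0 * y a 0).
  transitivity (\sum_a (l2norm y ^+ 2 * x a 0 ^+ 2 +
      l2norm x ^+ 2 * y a 0 ^+ 2 -
      2 * (l2norm x * l2norm y) * (x a 0 * y a 0))).
    by apply: eq_bigr => a _; ring.
  rewrite sumrB big_split/= -!mulr_sumr -!sqr_l2norm; ring.
by rewrite pmulr_rge0 ?subr_ge0// mulr_gt0.
Qed.

Lemma l2normD n (x y : 'cV[R]_n) : l2norm (x + y) <= l2norm x + l2norm y.
Proof.
rewrite -ler_sqr ?nnegrE ?addr_ge0 ?l2norm_ge0// sqr_l2norm sqrrD !sqr_l2norm.
under eq_bigr do rewrite mxE sqrrD.
rewrite !big_split/= lerD2r lerD2l mulr2n.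
by rewrite lerD ?cauchy_schwarz.
Qed.

Lemma l2norm_sum n (I : Type) (s : seq I) (x : I -> 'cV[R]_n) :
  l2norm (\sum_(i <- s) x i) <= \sum_(i <- s) l2norm (x i).
Proof.
elim/big_ind2: _ => [|c u c' u' cu cu'|//]; first by rewrite l2norm0.
exact: le_trans (l2normD _ _) (lerD cu cu').
Qed.

(** Cauchy-Schwarz on each row, with the Frobenius norm as constant. This crude bound serves to show
    that the supremum defining [spectral_norm] is finite. *)
Lemma l2norm_mulmx_bound m n (A : 'M[R]_(m, n)) (x : 'cV[R]_n) :
  l2norm (A *m x) <= Num.sqrt (\sum_i l2norm (row i A)^T ^+ 2) * l2norm x.
Proof.
rewrite -[l2norm x]ger0_norm ?l2norm_ge0// -sqrtr_sqr -sqrtrM; last first.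
  by apply: sumr_ge0 => a _; exact: sqr_ge0.
apply: ler_wsqrtr; rewrite mulr_suml; apply: ler_sum => i _.
rewrite -exprMn -[leLHS]real_normK ?num_real//.
rewrite lerXn2r ?nnegrE ?mulr_ge0 ?l2norm_ge0//.
have rowE (z : 'cV[R]_n) : (A *m z) i 0 = \sum_a (row i A)^T a 0 * z a 0.
  by rewrite mxE; apply: eq_bigr => a _; rewrite !mxE.
rewrite ler_norml rowE cauchy_schwarz andbT lerNl.
(* [cauchy_schwarz] carries no absolute value, so the lower bound comes from applying it to
   [- x]. *)
have := cauchy_schwarz (row i A)^T (- x).
rewrite -rowE mulmxN [X in X <= _]mxE rowE -[- x]scaleN1r.
by rewrite l2normZ normrN1 mul1r.
Qed.

(** Without an upper bound, [sup] would take its default value 0 and would not dominate the set. *)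
Lemma spectral_norm_has_ubound m n (A : 'M[R]_(m, n)) :
  has_ubound
    [set l2norm (A *m x) | x in [set x : 'cV[R]_n | l2norm x <= 1]]%classic.
Proof.
exists (Num.sqrt (\sum_i l2norm (row i A)^T ^+ 2)) => _ [z /= z1 <-].
rewrite (le_trans (l2norm_mulmx_bound _ _))//.
by rewrite -[leRHS]mulr1 ler_wpM2l ?sqrtr_ge0.
Qed.

(** A nonzero [x] is rescaled to a unit vector, which belongs to the set under the supremum. *)
Lemma l2norm_mulmx m n (A : 'M[R]_(m, n)) (x : 'cV[R]_n) :
  l2norm (A *m x) <= spectral_norm A * l2norm x.
Proof.
have [/l2norm_eq0->|x0] := eqVneq (l2norm x) 0.
  by rewrite mulmx0 !l2norm0 mulr0.
have x_gt0 : 0 < l2norm x by rewrite lt0r x0 l2norm_ge0.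
rewrite -ler_pdivrMr// mulrC -[(l2norm x)^-1]ger0_norm ?invr_ge0 ?l2norm_ge0//.
rewrite -l2normZ scalemxAr; apply/(ub_le_sup (spectral_norm_has_ubound A)).
exists ((l2norm x)^-1 *: x) => //=.
by rewrite l2normZ ger0_norm ?invr_ge0 ?l2norm_ge0// mulVf.
Qed.

Lemma spectral_norm_le m n (A : 'M[R]_(m, n)) c : 0 <= c ->
  (forall x : 'cV[R]_n, l2norm (A *m x) <= c * l2norm x) ->
  spectral_norm A <= c.
Proof.
move=> c0 Ac; apply: sup_le_ub.
  by exists (l2norm (A *m 0)), 0 => //=; rewrite l2norm0.
move=> _ [x /= x1 <-]; rewrite (le_trans (Ac x))//.
by rewrite -[leRHS]mulr1 ler_wpM2l.
Qed.

Lemma spectral_norm_ge0 m n (A : 'M[R]_(m, n)) : 0 <= spectral_norm A.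
Proof.
apply: (ub_le_sup (spectral_norm_has_ubound A)).
by exists 0; rewrite /= ?mulmx0 l2norm0.
Qed.

(* |A^T y|^2 = <y, A A^T y> *)
Lemma l2norm_mulmx_tr m n (A : 'M[R]_(m, n)) (y : 'cV[R]_m) :
  l2norm (A^T *m y) <= spectral_norm A * l2norm y.
Proof.
have [->|x0] := eqVneq (l2norm (A^T *m y)) 0.
  by rewrite mulr_ge0 ?spectral_norm_ge0 ?l2norm_ge0.
have x_gt0 : 0 < l2norm (A^T *m y) by rewrite lt0r x0 l2norm_ge0.
rewrite -(ler_pM2r x_gt0) -expr2 sqr_l2norm.
have -> : \sum_a (A^T *m y) a 0 ^+ 2 =
    \sum_b y b 0 * (A *m (A^T *m y)) b 0.
  transitivity (((A^T *m y)^T *m (A^T *m y)) 0 0).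
    by rewrite mxE; apply: eq_bigr => a _; rewrite [_^T _ _]mxE.
  rewrite trmx_mul trmxK -mulmxA mxE.
  by apply: eq_bigr => a _; rewrite [_^T _ _]mxE.
rewrite (le_trans (cauchy_schwarz _ _))// mulrAC [leRHS]mulrC.
by rewrite ler_wpM2l ?l2norm_ge0 ?l2norm_mulmx.
Qed.

End EuclideanNorm.

(** * Differentials, entry by entry, of matrix-valued maps *)

Lemma is_diff_sum (R : numFieldType) (V U : normedModType R) (n : nat)
    (f df : 'I_n -> V -> U) (x : V) :
  (forall i, is_diff x (f i) (df i)) ->
  is_diff x (fun z => \sum_i f i z) (fun v => \sum_i df i v).
Proof.
move=> fdf.
rewrite (_ : (fun z => \sum_i f i z) = \sum_i f i); last first.
  by apply/funext => z; rewrite fct_sumE.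
rewrite (_ : (fun z => \sum_i df i z) = \sum_i df i); last first.
  by apply/funext => z; rewrite fct_sumE.
by elim/big_ind2: _ => // [|? ? ? ?]; [exact: is_diff_cst|exact: is_diffD].
Qed.

(** A coordinate is linear and continuous, hence its own differential; it is packed as a linear map
    to make [diff_lin] applicable. *)
Lemma is_diff_coord (R : numFieldType) (m n : nat) (M : 'M[R]_(m, n)) i j :
  is_diff M (fun N : 'M[R]_(m, n) => N i j : R) (fun N => N i j).
Proof.
have lin : linear (fun N : 'M[R]_(m, n) => N i j : R^o).
  by move=> c N1 N2; rewrite !mxE.
pose linM := GRing.isLinear.Build _ _ _ _ _ lin.
pose f : {linear 'M[R]_(m, n) -> R^o} :=
  HB.pack (fun N : 'M[R]_(m, n) => N i j : R^o) linM.
apply: DiffDef; first exact: differentiable_coord.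
by rewrite (@diff_lin _ _ _ f)//; exact: coord_continuous.
Qed.

Lemma differentiable_row (R : realType) (V : normedModType R) (n : nat)
    (f : V -> 'rV[R]_n) (x : V) :
  (forall a, differentiable (fun z => f z 0 a) x) -> differentiable f x.
Proof.
move=> df; rewrite (_ : f = \sum_(a < n) (fun z => f z 0 a *: delta_mx 0 a)).
  by apply: differentiable_sum => a; exact: differentiableZl.
by apply/funext => z; rewrite fct_sumE -row_sum_delta.
Qed.

(** Chain rule for one layer. Working entrywise reduces it to the scalar function [f] composed with
    a linear combination of the entries of [H]. *)
Lemma is_diff_layer (R : realType) (V : normedModType R) (n m p q : nat)
    (A : 'M[R]_(n, m)) (W : 'M[R]_(p, q)) (f : R -> R)
    (H dH : V -> 'M[R]_(m, p)) (x : V) :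
  (forall t, derivable f t 1) ->
  (forall u a, is_diff x (fun z => H z u a) (fun v => dH v u a)) ->
  forall u b, is_diff x (fun z => map_mx f (A *m H z *m W) u b)
    (fun v => f^`()%classic ((A *m H x *m W) u b) * (A *m dH v *m W) u b).
Proof.
move=> fD HD u b.
have pre : is_diff x (fun z => (A *m H z *m W) u b)
    (fun v => (A *m dH v *m W) u b).
  (* [G] is arbitrary because the expansion is used for both [H] and [dH]. *)
  have E (G : V -> 'M[R]_(m, p)) : (fun z => (A *m G z *m W) u b) =
      fun z => \sum_a \sum_w (A u w * W a b) * G z w a.
    apply/funext => z; rewrite mxE; apply: eq_bigr => a _.
    by rewrite mxE mulr_suml; apply: eq_bigr => w _; rewrite mulrAC.
  rewrite (E H) (E dH); apply: is_diff_sum => a; exact: is_diff_sum.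
have out : is_diff ((A *m H x *m W) u b) f
    (fun h => f^`()%classic ((A *m H x *m W) u b) * h).
  have fdiff := (derivable1_diffP f ((A *m H x *m W) u b)).1 (fD _).
  apply: DiffDef => //; rewrite diff1E//.
  by apply/funext => h; rewrite mulrC.
rewrite (_ : (fun z => _) = f \o (fun z => (A *m H z *m W) u b)); last first.
  by apply/funext => z; rewrite /= [LHS]mxE.
exact: is_diff_comp.
Qed.

(** * Differential of the propagation with respect to one initial row *)

Section Propagation.
Variables (R : realType) (n : nat) (A : 'M[R]_n) (d : nat -> nat).
Variables (W : forall l, 'M[R]_(d l, d l.+1)) (sigma : nat -> R -> R).
Hypothesis sigma_diff : forall l t, derivable (sigma l) t 1.
Variables (H0 : 'M[R]_(n, d 0%N)) (s : 'I_n) (alpha beta : R).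

Lemma absmx_exp_ge0 l u v : 0 <= (absmx A ^+ l) u v.
Proof.
elim: l u v => [|l IH] u v; first by rewrite expr0 mxE ler0n.
rewrite exprS mxE sumr_ge0// => w _.
by rewrite mulr_ge0// mxE.
Qed.

(** The differential is carried through the induction as a matrix-valued map [dH]: the bound on row
    [u] at the next layer needs the bounds on all rows at the current one. *)
Lemma propagate_diff_bound (l : nat) :
  (forall k, (k < l)%N -> forall t, `|(sigma k)^`()%classic t| <= alpha) ->
  (forall k, (k < l)%N -> spectral_norm (W k) <= beta) ->
  exists dH : 'rV[R]_(d 0%N) -> 'M[R]_(n, d l),
    (forall u a, is_diff (row s H0)
       (fun x => propagate A W sigma (set_row s x H0) l u a)
       (fun v => dH v u a)) /\
    (forall v u, l2norm (row u (dH v))^T <=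
       (alpha * beta) ^+ l * (absmx A ^+ l) u s * l2norm v^T).
Proof.
elim: l => [_ _|l IH sigma_le W_le].
  (* At layer 0 a perturbation [v] appears in row [s] alone, which matches the entries [(u, s)] of
     the identity [absmx A ^+ 0]. *)
  exists (fun v => set_row s v 0); split=> [u a|v u] /=.
    have [us|us] := eqVneq u s.
      rewrite (_ : (fun x => _) = (fun x : 'rV_(d 0%N) => x 0 a)); last first.
        by apply/funext => x; rewrite mxE us eqxx.
      rewrite (_ : (fun v => _) = (fun x : 'rV_(d 0%N) => x 0 a)); last first.
        by apply/funext => x; rewrite mxE us eqxx.
      exact: is_diff_coord.
    rewrite (_ : (fun x => _) = cst (H0 u a)); last first.
      by apply/funext => x; rewrite mxE (negPf us).
    rewrite (_ : (fun v => _) = cst 0); last first.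
      by apply/funext => x; rewrite !mxE (negPf us).
    exact: is_diff_cst.
  rewrite !expr0 mul1r mxE.
  have [->|us] := eqVneq u s.
    rewrite mul1r (_ : row s _ = v)//.
    by apply/rowP => a; rewrite !mxE eqxx.
  rewrite mul0r (_ : row u _ = 0) ?trmx0 ?l2norm0//.
  by apply/rowP => a; rewrite !mxE (negPf us).
have [k kl|k kl|dH [dHP dHle]] := IH.
- by apply: sigma_le; exact: ltnW.
- by apply: W_le; exact: ltnW.
(* The base point is left in this form, rather than as [H0], to agree with what [is_diff_layer]
   yields at [row s H0]. *)
pose H := propagate A W sigma (set_row s (row s H0) H0) l.
pose dH' v := \matrix_(u, b)
  ((sigma l)^`()%classic ((A *m H *m W l) u b) * (A *m dH v *m W l) u b).
exists dH'; split=> [u b|v u].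
  have -> : (fun v => dH' v u b) = fun v =>
      (sigma l)^`()%classic ((A *m H *m W l) u b) * (A *m dH v *m W l) u b
    by apply/funext => v; rewrite mxE.
  exact: (is_diff_layer A (W l) (@sigma_diff l) dHP u b).
have alpha_ge0 : 0 <= alpha by apply: le_trans (sigma_le _ (ltnSn l) 0).
have beta_ge0 : 0 <= beta.
  exact: le_trans (spectral_norm_ge0 _) (W_le _ (ltnSn l)).
(* The activation only multiplies each entry by a derivative of size at most [alpha]. *)
apply: (@le_trans _ _ (alpha * l2norm (row u (A *m dH v *m W l))^T)).
  apply: l2norm_le => // b; rewrite !mxE normrM ler_wpM2r//.
  exact: sigma_le.
rewrite exprS -!mulrA ler_wpM2l// row_mul trmx_mul.
(* Weights act on rows from the right, that is, by the transpose of [W l] on columns; hence the use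
   of [l2norm_mulmx_tr]. *)
apply: (@le_trans _ _ (beta * l2norm (row u (A *m dH v))^T)).
  rewrite (le_trans (l2norm_mulmx_tr _ _))// ler_wpM2r ?l2norm_ge0//.
  exact: W_le.
(* Row [u] of [A *m dH v] is the combination of the rows [w] of [dH v] with coefficients [A u w].
   The triangle inequality and the induction hypothesis then produce row [u] of [absmx A] times
   [absmx A ^+ l]. *)
rewrite ler_wpM2l// row_mul mulmx_sum_row linear_sum/=.
rewrite (le_trans (l2norm_sum _ _))// exprS mxE mulr_suml mulr_sumr.
apply: ler_sum => w _; rewrite linearZ/= l2normZ !mxE.
by rewrite -mulrA mulrCA ler_wpM2l// mulrA.
Qed.

(** Applied to a column [x], the Jacobian gives the transpose of row [i] of [dH x^T], so the row
    bound for every direction is a bound on the operator norm. *)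
Lemma spectral_norm_node_jacobian (r : nat) (i : 'I_n) :
  (forall k, (k < r)%N -> forall t, `|(sigma k)^`()%classic t| <= alpha) ->
  (forall k, (k < r)%N -> spectral_norm (W k) <= beta) ->
  0 <= alpha * beta ->
  spectral_norm (node_jacobian A W sigma H0 r i s) <=
    (alpha * beta) ^+ r * (absmx A ^+ r) i s.
Proof.
move=> sigma_le W_le ab.
have [dH [dHP dHle]] := propagate_diff_bound sigma_le W_le.
apply: spectral_norm_le => [|x].
  by rewrite mulr_ge0 ?exprn_ge0 ?absmx_exp_ge0.
(* This turns the product into the transpose of [x^T] times the library [jacobian], which is a
   directional derivative. *)
rewrite -[x]trmxK -trmx_mul.
set f := fun y => row i _.
have fE a : (fun z => f z 0 a) =
    (fun z => propagate A W sigma (set_row s z H0) r i a).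
  by apply/funext => z; rewrite mxE.
have fD : differentiable f (row s H0).
  apply: differentiable_row => a; rewrite fE.
  by have [] := dHP i a.
rewrite -deriveEjacobian// derive_mx; last exact: diff_derivable.
rewrite (_ : \matrix_(_, _) _ = row i (dH x^T))//.
apply/matrixP => k a; rewrite ord1 !mxE fE.
by have [? dE] := dHP i a; rewrite deriveE// dE.
Qed.

End Propagation.

Theorem proposition3 (R : realType) (N K : nat) (e : rel 'I_N)
  (e_sym : symmetric e) (e_conn : connected_graph e)
  (e_nbip : ~ bipartite e)
  (L : eqType) (known : {set 'I_N}) (y : 'I_N -> L) (yt : 'I_K -> L)
  (d : nat -> nat) (W : forall l : nat, 'M[R]_(d l, d l.+1))
  (sigma : nat -> R -> R)
  (sigma_diff : forall (l : nat) (t : R), derivable (sigma l) t 1)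
  (H0 : 'M[R]_(N + K, d 0%N))
  (i s : 'I_N) (r : nat) (alpha beta : R)
  (sigma_bound : forall l : nat, (l <= r)%N ->
     forall t : R, `|(sigma l)^`()%classic t| <= alpha)
  (W_bound : forall l : nat, (l <= r)%N -> spectral_norm (W l) <= beta) :
  let Ac := signed_adjacency R e known y yt in
  spectral_norm
    (node_jacobian Ac W sigma H0 r (lshift K i) (lshift K s))
  <= (2 * alpha * beta) ^+ r *
     (\sum_(0 <= l < r.+1) absmx Ac ^+ l) (lshift K i) (lshift K s).
Proof.
cbv zeta; set Ac := signed_adjacency _ _ _ _ _.
(* The hypotheses always cover layer 0, even for [r = 0], so both constants dominate a nonnegative
   quantity. *)
have alpha_ge0 : 0 <= alpha by apply: le_trans (sigma_bound _ (leq0n r) 0).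
have beta_ge0 : 0 <= beta.
  exact: le_trans (spectral_norm_ge0 _) (W_bound _ (leq0n r)).
have ab_ge0 : 0 <= alpha * beta by rewrite mulr_ge0.
have lt_sigma k : (k < r)%N -> forall t, `|(sigma k)^`()%classic t| <= alpha.
  by move=> /ltnW; exact: sigma_bound.
have lt_W k : (k < r)%N -> spectral_norm (W k) <= beta.
  by move=> /ltnW; exact: W_bound.
apply: le_trans
  (spectral_norm_node_jacobian _ sigma_diff _ _ _ lt_sigma lt_W ab_ge0) _.
(* The factors are compared separately: [alpha * beta] with its double, then the power [r] with the
   whole sum, whose last term it is and whose other terms have nonnegative entries. *)
apply: ler_pM; rewrite ?exprn_ge0 ?absmx_exp_ge0//.
  by rewrite lerXn2r ?nnegrE -?mulrA ?mulr_ge0// ler_peMl// ler1n.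
rewrite big_nat_recr//= mxE lerDr.
by rewrite summxE sumr_ge0// => l _; exact: absmx_exp_ge0.
Qed.
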